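(* Let $k$ be an algebraically closed field in which $4$ is invertible, let $m\ge 1$, and let $A = k[x_1,\dots,x_m]$. Let $f\in A$ be an irreducible polynomial and let $T = A[z]/(z^4-f)$. Then $T^\ast = k^\ast$.
   Context: For a commutative ring $B$, $B^\ast$ denotes its group of units. The ring $T$ is the coordinate ring of the affine variety $z^4=f$ in $\mathbb A^{m+1}$; it is an integrally closed integral domain containing $k$. *)

(* Defs.v *)
From HB Require Import structures.
From mathcomp Require Import all_boot all_order all_algebra.
From mathcomp Require Import mpoly.

Set Implicit Arguments.
Unset Strict Implicit.
Unset Printing Implicit Defensive.

Import GRing.Theory.
Local Open Scope ring_scope.

Definition irreducible_elt (R : idomainType) (p : R) : Prop :=
  [/\ p != 0, p \isn't a GRing.unit &
      forall a b : R, p = a * b -> (a \is a GRing.unit) \/ (b \is a GRing.unit)].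

(* The library equips [{poly %/ h}] with a [GRing.unit] predicate only over a
   field of coefficients, whereas below the coefficients are polynomials. *)
Definition invertible (R : comNzRingType) (u : R) : Prop :=
  exists v : R, u * v = 1.

(* [{poly %/ h}] is the quotient by [mk_monic h], which falls back to ['X] when
   [h] is not monic of positive degree; the next lemma rules the fallback out. *)
Definition quartic (R : nzRingType) (f : R) : {poly R} := 'X^4 - f%:P.

Lemma mk_monic_quartic (R : nzRingType) (f : R) :
  mk_monic (quartic f) = quartic f.
Proof.
by rewrite /mk_monic /quartic size_XnsubC // monicXnsubC.
Qed.

(* The structure map k -> A -> T. *)
Definition quartic_const (k : idomainType) (m : nat) (f : {mpoly k[m]}) (c : k)
  : {poly %/ quartic f} := qpolyC (quartic f) c%:MP.

(* Main.v *)
Require Import Defs.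
From mathcomp Require Import all_boot all_order all_algebra.
From mathcomp Require Import mpoly ring zify.
From Stdlib Require Import Classical_Prop.

Set Implicit Arguments.
Unset Strict Implicit.
Unset Printing Implicit Defensive.

Import GRing.Theory.
Local Open Scope ring_scope.

(** Write [A] for the polynomial ring, [z] for the class of ['X] in [T], [i] for
    a square root of [-1] in [k], and [sigma] for the automorphism of [T] over
    [A] that sends [z] to [i * z].  Two facts carry the proof: every unit of [T]
    is a constant times the square of a unit, and a degree count prevents square
    roots of a non-constant unit from being extracted for ever.

    Units are squares.  A unit [u] can be scaled by a constant to have norm [1]
    over [A], and Hilbert's theorem 90 then gives a nonzero [y] with
    [u * sigma y = y].  The ideal [y T] is stable under [sigma].  As [A] is
    factorial and [T] is ramified over [A] only along the prime [f], where [z]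
    generates the prime above it, such an ideal is generated by an element of
    [A] times a power of [z].  Dividing [y] by that generator leaves a unit [v]
    with [u = c * v / sigma v] ([eigenvector_unit], [unit_quotient]).  Writing
    [v] in the same form, [v = c' * w / sigma w], gives
    [u = c * w * sigma (sigma w) / (sigma w) ^ 2].  Here [w * sigma (sigma w)]
    is a unit fixed by [sigma ^ 2], that is, a unit of [A[z^2]], and those are
    constants ([unit_fixed_const]); so [u] is a constant times a square
    ([unit_square]).

    Degrees.  If [u = c * g ^ 2], where [g * sigma (sigma g)] is a constant, the
    coefficient of [z ^ 2] in [u] is [4 * c * g_0 * g_2], so the degree of that
    coefficient cannot increase from [u] to [g].  It decreases within two steps,
    unless the product vanishes; and in that case the equation
    [x ^ 2 + f * y ^ 2 = 0], which has no nonzero solution since [f] is prime,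
    makes [g] constant ([invertible_quartic]).

    The argument uses that irreducible polynomials in several variables are
    prime.  This is Gauss's lemma ([poly_irreducibles_prime]), applied to one
    variable after the other ([mpoly_irreducibles_prime]). *)

(** * Divisibility and degree functions *)

Definition divides (R : idomainType) (a b : R) : Prop := exists c, b = a * c.

Definition prime_elt (R : idomainType) (p : R) : Prop :=
  [/\ p != 0, p \isn't a GRing.unit &
      forall a b, divides p (a * b) -> divides p a \/ divides p b].

Definition irreducibles_prime (R : idomainType) : Prop :=
  forall p : R, irreducible_elt p -> prime_elt p.

(** What the descents need of the total degree of polynomials; the last clause
    makes the elements of degree zero play the part of the constants. *)
Definition degree_function (R : idomainType) (mu : R -> nat) : Prop :=
  [/\ forall a b, a != 0 -> b != 0 -> mu (a * b) = (mu a + mu b)%N,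
      forall a b, (mu (a + b)%R <= maxn (mu a) (mu b))%N &
      forall a, a != 0 -> mu a = 0%N -> a \is a GRing.unit].

Section DegreeFunction.

Variables (R : idomainType) (mu : R -> nat).
Hypothesis mu_deg : degree_function mu.

Lemma degM a b : a != 0 -> b != 0 -> mu (a * b) = (mu a + mu b)%N.
Proof. by case: mu_deg => muM _ _; apply: muM. Qed.

Lemma deg_leD a b : (mu (a + b)%R <= maxn (mu a) (mu b))%N.
Proof. by case: mu_deg. Qed.

Lemma deg_eq0_unit a : a != 0 -> mu a = 0%N -> a \is a GRing.unit.
Proof. by case: mu_deg => _ _; apply. Qed.

Lemma deg1 : mu 1 = 0%N.
Proof.
have := degM (oner_neq0 R) (oner_neq0 R); rewrite mulr1 => /eqP.
by rewrite -{1}[mu 1]addn0 eqn_add2l eq_sym => /eqP.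
Qed.

Lemma deg_unit a : a \is a GRing.unit -> mu a = 0%N.
Proof.
move=> ua; have a0 : a != 0 by apply: contraTneq ua => ->; rewrite unitr0.
have := degM a0 (invr_neq0 a0); rewrite divrr // deg1; lia.
Qed.

Lemma degN a : mu (- a) = mu a.
Proof.
have [->|a0] := eqVneq a 0; first by rewrite oppr0.
rewrite -mulN1r degM ?oppr_eq0 ?oner_neq0 //.
by rewrite deg_unit // unitrN unitr1.
Qed.

Lemma deg0 : mu 0 = 0%N.
Proof.
by have := deg_leD 1 (- 1); rewrite subrr degN deg1 leqn0 => /eqP.
Qed.

Lemma deg_gt0 a : a != 0 -> a \isn't a GRing.unit -> (0 < mu a)%N.
Proof.
by move=> a0 Ua; rewrite lt0n; apply: contra Ua => /eqP; apply: deg_eq0_unit.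
Qed.

Lemma degMunit c a : c \is a GRing.unit -> mu (c * a) = mu a.
Proof.
move=> uc; have c0 : c != 0 by apply: contraTneq uc => ->; rewrite unitr0.
have [->|a0] := eqVneq a 0; first by rewrite mulr0.
by rewrite degM // deg_unit.
Qed.

(** A nonzero non-unit factor of least degree is irreducible: the degree drops
    in every proper factorization. *)
Lemma exists_irreducible_factor a : a != 0 -> a \isn't a GRing.unit ->
  exists2 p : R, irreducible_elt p & divides p a.
Proof.
have [n le_an] := ubnP (mu a); elim: n => // n IHn in a le_an * => a0 Ua.
have reducible p q : p * q = a -> p \isn't a GRing.unit ->
    q \isn't a GRing.unit -> exists2 r, irreducible_elt r & divides r a.
  move=> eq_a Up Uq; move: (a0); rewrite -eq_a mulf_eq0 => /norP[p0 q0].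
  have mu_a : mu a = (mu p + mu q)%N by rewrite -eq_a degM.
  have mu_q := deg_gt0 q0 Uq.
  have [|r irr_r [s eq_p]] := IHn p _ p0 Up; first lia.
  by exists r => //; exists (s * q); rewrite mulrA -eq_p eq_a.
have [[p [q [eq_a Up Uq]]]|irr] := classic
  (exists p q, [/\ p * q = a, p \isn't a GRing.unit & q \isn't a GRing.unit]).
  exact: (reducible p q).
exists a; last by exists 1; rewrite mulr1.
split=> // p q eq_a; case Up: (p \is a GRing.unit); first by left.
right; case Uq: (q \is a GRing.unit) => //; case: irr.
by exists p, q; rewrite Up Uq.
Qed.

End DegreeFunction.

(** * Gauss's lemma *)

Section Gauss.

Variables (R : idomainType) (mu : R -> nat).
Hypothesis mu_deg : degree_function mu.
Hypothesis R_prime : irreducibles_prime R.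

Lemma divides_polyCP (c : R) (p : {poly R}) :
  divides c%:P p <-> forall i, divides c p`_i.
Proof.
split=> [[q ->] i|c_p]; first by exists q`_i; rewrite coefCM.
have c_pb i : exists b, p`_i == c * b by have [b ->] := c_p i; exists b.
exists (\poly_(i < size p) xchoose (c_pb i)); apply/polyP=> i.
rewrite coefCM coef_poly; case: ltnP => [_|le_p]; first exact/eqP/(xchooseP (c_pb i)).
by rewrite mulr0 nth_default.
Qed.

(** Compare constant coefficients: if [c] divides [p * q], it divides that of [p]
    or that of [q], which can be removed, and the remaining ['X] cancelled. *)
Lemma prime_polyC (c : R) : prime_elt c -> prime_elt c%:P.
Proof.
case=> c0 Uc c_prime; split; first by rewrite polyC_eq0.
  by rewrite poly_unitE size_polyC c0 coefC.
have divX (p : {poly R}) : divides c%:P (p * 'X) -> divides c%:P p.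
  move=> /divides_polyCP c_p; apply/divides_polyCP=> i.
  by have := c_p i.+1; rewrite coefMX.
have consX (p : {poly R}) a : divides c%:P p -> divides c a ->
    divides c%:P (p * 'X + a%:P).
  by case=> q -> [b ->]; exists (q * 'X + b%:P); rewrite polyCM; ring.
elim/poly_ind=> [q _|p a IHp q c_pq]; first by left; exists 0; rewrite mulr0.
have [c_a|c'a] := classic (divides c a).
  have [|c_p|c_q] := IHp q; last by right.
    apply: divX; case: c_pq c_a => r eq_r [b eq_b]; exists (r - b%:P * q).
    by rewrite mulrBr mulrA -polyCM -eq_b -eq_r; ring.
  by left; apply: consX.
right; elim/poly_ind: q c_pq => [_|q b IHq c_pq].
  by exists 0; rewrite mulr0.
have c_b : divides c b.
  have /divides_polyCP/(_ 0%N) := c_pq.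
  rewrite coef0M !coefD !coefMX !coefC /= !add0r.
  by case/c_prime.
apply: consX => //; apply/IHq/divX.
case: c_pq c_b => r eq_r [d eq_d]; exists (r - d%:P * (p * 'X + a%:P)).
by rewrite mulrBr mulrA -polyCM -eq_d -eq_r; ring.
Qed.

(** The primes of [c] divide [q * d], hence can be cancelled one at a time,
    each from whichever factor it divides. *)
Lemma clear_denominator (c : R) (p q d : {poly R}) : c != 0 ->
  c *: p = q * d ->
  exists a b q' d', [/\ p = q' * d', q = a *: q' & d = b *: d'].
Proof.
have [n le_cn] := ubnP (mu c); elim: n => // n IHn in c q d le_cn *.
move=> c0 eq_cp; case Uc: (c \is a GRing.unit).
  exists c, 1, (c^-1 *: q), d; split; last by rewrite scale1r.
    by rewrite -scalerAl -eq_cp scalerA mulVr ?scale1r.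
  by rewrite scalerA divrr ?scale1r.
have [s irr_s [b eq_c]] := exists_irreducible_factor mu_deg c0 (negbT Uc).
have s_prime := R_prime irr_s; have [s0 Us _] := s_prime.
have b0 : b != 0 by apply: contraNneq c0 => b0; rewrite eq_c b0 mulr0.
have lt_bn : (mu b < n)%N.
  by have := deg_gt0 mu_deg s0 Us; move: le_cn; rewrite eq_c (degM mu_deg) //; lia.
have sP0 : s%:P != 0 by rewrite polyC_eq0.
have [_ _ sP_prime] := prime_polyC s_prime.
have /sP_prime[[r eq_r]|[r eq_r]] : divides s%:P (q * d).
- by exists (b *: p); rewrite -eq_cp eq_c mul_polyC scalerA.
- have [|a1 [b1 [q1 [d1 [-> eq_q ->]]]]] := IHn b r d lt_bn b0.
    apply: (mulfI sP0); rewrite mulrA -eq_r -eq_cp eq_c.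
    by rewrite mul_polyC scalerA.
  exists (s * a1), b1, q1, d1; split=> //.
  by rewrite eq_r eq_q mul_polyC scalerA.
have [|a1 [b1 [q1 [d1 [-> -> eq_d]]]]] := IHn b q r lt_bn b0.
  apply: (mulfI sP0); rewrite mulrCA -eq_r -eq_cp eq_c.
  by rewrite mul_polyC scalerA.
exists a1, (s * b1), q1, d1; split=> //.
by rewrite eq_r eq_d mul_polyC scalerA.
Qed.

(** [p %| h] is divisibility over the field of fractions of [R]. *)
Lemma irreducible_dvdp (p h : {poly R}) : (1 < size p)%N ->
  irreducible_elt p -> (p %| h)%R -> divides p h.
Proof.
move=> p_gt1 [p0 _ p_irr] /Pdiv.Idomain.dvdpP[[c q] /= c0 eq_ch].
have [a [b [q' [p' [eq_h _ eq_p]]]]] := clear_denominator c0 eq_ch.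
have b0 : b != 0 by apply: contraNneq p0 => b0; rewrite eq_p b0 scale0r.
have := p_irr b%:P p'; rewrite mul_polyC => /(_ eq_p)[Ub|].
  have {}Ub : b \is a GRing.unit by move: Ub; rewrite poly_unitE coefC => /andP[].
  exists (b^-1 *: q'); rewrite eq_h eq_p.
  by rewrite -scalerAr -scalerAl scalerA mulVr // scale1r mulrC.
rewrite poly_unitE => /andP[/eqP p'1 _].
by move: p_gt1; rewrite eq_p size_scale ?p'1.
Qed.

(** Gauss's lemma: over the field of fractions of [R], the gcd of [p] and [g] is
    a divisor of [p], and clearing denominators turns it into a divisor over
    [R]; as [p] is irreducible, the gcd is either [p] or [1] up to scalars. *)
Lemma poly_irreducibles_prime : irreducibles_prime {poly R}.
Proof.
move=> p irr_p; have [p0 Up p_irr] := irr_p.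
have [p_gt1|] := ltnP 1 (size p); last first.
  move/size1_polyC; set c := p`_0 => eq_p; rewrite eq_p in p0 Up p_irr *.
  apply/prime_polyC/R_prime; split; first by rewrite -polyC_eq0.
    by move: Up; rewrite poly_unitE coefC size_polyC -polyC_eq0 p0.
  move=> a b eq_c; have := p_irr a%:P b%:P.
  rewrite -polyCM eq_c !poly_unitE !coefC /= => /(_ erefl).
  by case=> /andP[_]; [left|right].
split=> // g h p_gh; have {p_gh}p_gh : p %| g * h.
  by case: p_gh => r ->; apply: dvdp_mulr.
set d := gcdp p g; have d_p : d %| p := dvdp_gcdl p g.
have /Pdiv.Idomain.dvdpP[[c q] /= c0 eq_cp] := d_p.
have [a [b [q' [d' [eq_p _ eq_d]]]]] := clear_denominator c0 eq_cp.
have d0 : d != 0 by rewrite gcdp_eq0 negb_and p0.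
have b0 : b != 0 by apply: contraNneq d0 => b0; rewrite eq_d b0 scale0r.
have size_d : size d = size d' by rewrite eq_d size_scale.
case: (p_irr _ _ eq_p); rewrite poly_unitE => /andP[/eqP size1 _]; last first.
  have cop : coprimep p g by rewrite coprimep_def size_d size1.
  by right; apply: irreducible_dvdp => //; rewrite -(Gauss_dvdpr _ cop).
left; apply: irreducible_dvdp => //.
have eq_dp : d %= p.
  rewrite -dvdp_size_eqp // size_d eq_p size_mul; last 2 first.
  - by rewrite -size_poly_eq0 size1.
  - by rewrite -size_poly_eq0 -size_d size_poly_eq0.
  by rewrite size1.
by rewrite -(eqp_dvdl _ eq_dp) dvdp_gcdr.
Qed.

End Gauss.

(** * Polynomial rings have prime irreducibles *)

Section PolynomialRing.

Variable k : fieldType.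

Definition mdegree n (p : {mpoly k[n]}) : nat := (msize p).-1.

Lemma mdegreeP n : degree_function (@mdegree n).
Proof.
rewrite /mdegree; split=> [a b a0 b0|a b|a a0 a_deg0].
- by rewrite msizeM // (mpolySpred _ a0) (mpolySpred _ b0) /= addnS.
- move: (msizeD_le a b); move: (msize _) (msize _) (msize _) => x y z; lia.
have /msize1_polyC eq_a : (msize a <= 1)%N by rewrite (mpolySpred _ a0) a_deg0.
by rewrite unfold_in /= /mpoly_unit -eq_a eqxx unitfE -(mpolyC_eq0 n) -eq_a.
Qed.

Section LastVariable.

Variable n : nat.

Definition of_univariate (p : {poly {mpoly k[n]}}) : {mpoly k[n.+1]} :=
  (map_poly (@mwiden n k) p).['X_ord_max].

Lemma of_univariateM p q :
  of_univariate (p * q) = of_univariate p * of_univariate q.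
Proof. by rewrite /of_univariate rmorphM hornerM. Qed.

Lemma muniX m : muni 'X_[k, m] =
  'X_[[multinom m (widen_ord (leqnSn n) i) | i < n]] *: 'X^(m ord_max).
Proof. by rewrite muniE msuppX big_seq1 mcoeffX eqxx scale1r. Qed.

Lemma muniK : cancel (@muni n k) of_univariate.
Proof.
move=> p; rewrite [RHS]mpolyE muniE /of_univariate rmorph_sum horner_sum.
apply: eq_bigr => m _ /=; rewrite map_polyZ hornerZ map_polyXn hornerXn.
rewrite /= mwidenZ mwidenX -scalerAl mpolyXn -mpolyXD; congr (_ *: 'X_[_]).
apply/mnmP=> i; rewrite mnmDE. rewrite mulmnE mnm1E.
case: (unliftP ord_max i) => [j ->|->]; last first.
  by rewrite mnmwiden_ordmax eqxx mul1n.
rewrite (negPf (neq_lift _ _)) mul0n addn0.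
have -> : lift ord_max j = widen_ord (leqnSn n) j.
  exact/val_inj/lift_max.
by rewrite mnmwiden_widen mnmE.
Qed.

Lemma of_univariateK : cancel of_univariate (@muni n k).
Proof.
have mwidenK c : muni (mwiden c) = c%:P :> {poly {mpoly k[n]}}.
  elim/mpolyind: c => [|a m c _ _ IHc]; first by rewrite mwiden0 muni0.
  rewrite mwidenD muniD IHc mwidenZ mwidenX muniZ muniX polyCD; congr (_ + _).
  rewrite mnmwiden_ordmax expr0 alg_polyC -mul_polyC -polyCM mul_mpolyC.
  congr (_ *: 'X_[_])%:P; apply/mnmP=> i.
  by rewrite mnmE mnmwiden_widen.
elim/poly_ind=> [|p c IHp]; first by rewrite /of_univariate rmorph0 horner0 muni0.
rewrite /of_univariate rmorphD rmorphM /= map_polyX map_polyC hornerMXaddC.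
rewrite muniD muniM IHp mwidenK muniX mnm1E eqxx expr1; congr (_ * _ + _).
rewrite (_ : [multinom _ | _ < n] = 0%MM) ?mpolyX0 ?scale1r //.
apply/mnmP=> i; rewrite mnmE mnm1E mnm0E -val_eqE /=.
by rewrite gtn_eqF.
Qed.

End LastVariable.

Lemma mpoly_irreducibles_prime n : irreducibles_prime {mpoly k[n]}.
Proof.
elim: n => [|n IHn] p [p0 Up p_irr].
  (* Without variables every nonzero polynomial is a unit. *)
  case/negP: Up; apply: (deg_eq0_unit (@mdegreeP 0)) => //.
  have -> : p = (p@_0)%:MP.
    apply/mpolyP=> m; have -> : m = 0%MM by apply/mnmP; case.
    by rewrite mcoeffC eqxx mulr1.
  by rewrite /mdegree msizeC; case: eqP.
have muni_unit (a : {mpoly k[n.+1]}) :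
    muni a \is a GRing.unit -> a \is a GRing.unit.
  case/unitrP=> b [_ ab1]; apply/unitrP; exists (of_univariate b).
  by rewrite mulrC -{1 2}(muniK a) -of_univariateM ab1 -muni1 muniK.
have irr_p : irreducible_elt (muni p).
  split; first by rewrite (raddf_eq0 _ (can_inj (@muniK n))).
    exact: contra (@muni_unit _) Up.
  move=> a b eq_p; have := p_irr (of_univariate a) (of_univariate b).
  rewrite -of_univariateM -eq_p muniK => /(_ erefl).
  by case=> [Ua|Ub]; [left; rewrite -(of_univariateK a)|
     right; rewrite -(of_univariateK b)]; apply: rmorph_unit.
have [_ _ p_prime] := poly_irreducibles_prime (@mdegreeP n) IHn irr_p.
have divides_muni a : divides (muni p) (muni a) -> divides p a.
  by case=> q eq_a; exists (of_univariate q);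
     rewrite -(muniK a) eq_a of_univariateM muniK.
split=> // a b [c eq_ab]; have := p_prime (muni a) (muni b).
rewrite -muniM eq_ab muniM => /(_ (ex_intro _ (muni c) erefl)).
by case=> /divides_muni; [left|right].
Qed.

End PolynomialRing.

(** * The quartic extension and its automorphism *)

Section QuarticExtension.

Variables (A : idomainType) (f : A).

Local Notation T := {poly %/ quartic f}.

Local Notation cst := (qpolyC (quartic f)).
Definition root4 : T := in_qpoly (quartic f) 'X.

Local Notation z := root4.

Definition tuple4 (a b c d : A) : T :=
  cst a + cst b * z + cst c * z ^+ 2 + cst d * z ^+ 3.

Lemma cstE a : cst a = in_qpoly (quartic f) a%:P.
Proof.
apply/val_inj/esym/in_qpoly_small; rewrite mk_monic_quartic size_XnsubC //.
exact: leq_ltn_trans (size_polyC_leq1 _) _.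
Qed.

Lemma root4_pow4 : z ^+ 4 = cst f.
Proof.
rewrite /root4 cstE; apply/eqP; rewrite -subr_eq0 -rmorphXn -rmorphB /=.
apply/eqP/val_inj; rewrite /= mk_monic_quartic -/(quartic f).
by rewrite Pdiv.Ring.rmodpp // /GRing.comm mulrC.
Qed.

Lemma coef_tuple4 a b c d i :
  (tuple4 a b c d : {poly A})`_i = [:: a; b; c; d]`_i.
Proof.
have -> : tuple4 a b c d = in_qpoly (quartic f) (Poly [:: a; b; c; d]).
  rewrite /= !cons_poly_def /tuple4 !cstE /root4 -!rmorphXn -!rmorphM -!rmorphD /=.
  by congr in_qpoly; ring.
rewrite in_qpoly_small ?coef_Poly // mk_monic_quartic size_XnsubC //.
exact: leq_ltn_trans (size_Poly _) _.
Qed.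

Lemma tuple4P (y : T) : y = tuple4 y`_0 y`_1 y`_2 y`_3.
Proof.
apply/val_inj/polyP=> i; rewrite coef_tuple4.
case: i => [|[|[|[|i]]]] //=; rewrite nth_nil nth_default //.
by apply: leq_trans (size_npoly y) _; rewrite mk_monic_quartic size_XnsubC.
Qed.

Lemma tuple4_inj a b c d a' b' c' d' :
  tuple4 a b c d = tuple4 a' b' c' d' -> [/\ a = a', b = b', c = c' & d = d'].
Proof.
move=> eq_y.
have eq_i i : [:: a; b; c; d]`_i = [:: a'; b'; c'; d']`_i.
  by rewrite -coef_tuple4 eq_y coef_tuple4.
by split; [apply: (eq_i 0%N)|apply: (eq_i 1%N)|
           apply: (eq_i 2%N)|apply: (eq_i 3%N)].
Qed.

Lemma cst_tuple4 a : cst a = tuple4 a 0 0 0.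
Proof. by rewrite /tuple4 rmorph0; ring. Qed.

Lemma tuple4M a b c d a' b' c' d' :
  tuple4 a b c d * tuple4 a' b' c' d' =
  tuple4 (a * a' + f * (b * d' + c * c' + d * b'))
         (a * b' + b * a' + f * (c * d' + d * c'))
         (a * c' + b * b' + c * a' + f * (d * d'))
         (a * d' + b * c' + c * b' + d * a').
Proof.
rewrite /tuple4; move: root4_pow4; move: z => z z4.
rewrite !(rmorphD, rmorphM) /= -z4; ring.
Qed.

Lemma tuple4D a b c d a' b' c' d' :
  tuple4 a b c d + tuple4 a' b' c' d' =
  tuple4 (a + a') (b + b') (c + c') (d + d').
Proof. by rewrite /tuple4 !rmorphD /=; ring. Qed.


Lemma coef_cst a n : (cst a : {poly A})`_n = if n == 0%N then a else 0.
Proof. by rewrite qpolyCE coefC. Qed.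

Lemma cst_inj : injective cst.
Proof. by move=> a b; rewrite !cst_tuple4 => /tuple4_inj[]. Qed.

Lemma cst_mul_tuple4 e a b c d :
  cst e * tuple4 a b c d = tuple4 (e * a) (e * b) (e * c) (e * d).
Proof. by rewrite /tuple4 !rmorphM /=; ring. Qed.

Lemma root4_mul_tuple4 a b c d :
  root4 * tuple4 a b c d = tuple4 (f * d) a b c.
Proof.
rewrite /tuple4; move: root4_pow4; move: root4 => z z4.
rewrite rmorphM /= -z4; ring.
Qed.

Section Automorphism.

Variable i : A.
Hypothesis i2 : i ^+ 2 = - 1.
Hypothesis unit2 : (2 : A) \is a GRing.unit.

(** The [A]-automorphism [root4 |-> i * root4], using [i ^+ 3 = - i]. *)
Definition sigma (y : T) : T := tuple4 y`_0 (i * y`_1) (- y`_2) (- (i * y`_3)).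

Lemma sigma_tuple4 a b c d :
  sigma (tuple4 a b c d) = tuple4 a (i * b) (- c) (- (i * d)).
Proof. by rewrite /sigma !coef_tuple4. Qed.

Lemma sigma_cst a : sigma (cst a) = cst a.
Proof. by rewrite !cst_tuple4 sigma_tuple4 !mulr0 !oppr0. Qed.

Lemma sigmaM x y : sigma (x * y) = sigma x * sigma y.
Proof.
rewrite (tuple4P x) (tuple4P y).
move: x`_0 x`_1 x`_2 x`_3 y`_0 y`_1 y`_2 y`_3 => a b c d a' b' c' d'.
rewrite !(tuple4M, sigma_tuple4); congr tuple4; ring: i2.
Qed.


Lemma sigmaD x y : sigma (x + y) = sigma x + sigma y.
Proof.
rewrite (tuple4P x) (tuple4P y) tuple4D !sigma_tuple4 tuple4D.
by congr tuple4; ring.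
Qed.

Lemma sigma2_tuple4 a b c d :
  sigma (sigma (tuple4 a b c d)) = tuple4 a (- b) c (- d).
Proof. by rewrite !sigma_tuple4; congr tuple4; ring: i2. Qed.

Lemma sigma4 y : sigma (sigma (sigma (sigma y))) = y.
Proof. by rewrite (tuple4P y) !sigma2_tuple4 !opprK. Qed.

Lemma sigma1 : sigma 1 = 1.
Proof. by rewrite -(rmorph1 cst) sigma_cst. Qed.

Lemma sigma_root4 : sigma root4 = cst i * root4.
Proof.
have -> : root4 = tuple4 0 1 0 0 by rewrite /tuple4 !rmorph0 rmorph1; ring.
by rewrite sigma_tuple4 cst_mul_tuple4 !mulr0 !oppr0.
Qed.

Lemma double_eq0 (a : A) : a = - a -> a = 0.
Proof.
move=> eq_a; apply: (mulrI unit2); rewrite mulr0 mulr_natl mulr2n.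
by rewrite {1}eq_a addNr.
Qed.

Lemma sigma_fixed y : sigma y = y -> y = cst y`_0.
Proof.
rewrite {1 2 3}(tuple4P y) cst_tuple4.
move: y`_0 y`_1 y`_2 y`_3 => a b c d.
rewrite sigma_tuple4 => /tuple4_inj[_ eq_b eq_c eq_d].
congr tuple4; apply: double_eq0 => //.
- by transitivity (i * (i * b)); [rewrite !eq_b | ring: i2].
- by transitivity (- (i * - (i * d))); [rewrite !eq_d | ring: i2].
Qed.

(** The product of the conjugates is fixed by [sigma], hence equal to its constant
    coefficient. *)
Definition norm (y : T) : A :=
  (y * sigma y * sigma (sigma y) * sigma (sigma (sigma y)) : {poly A})`_0.

Lemma cst_norm y :
  cst (norm y) = y * sigma y * sigma (sigma y) * sigma (sigma (sigma y)).
Proof. by rewrite -sigma_fixed // !sigmaM sigma4; ring. Qed.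

Lemma normM x y : norm (x * y) = norm x * norm y.
Proof.
by apply: cst_inj; rewrite rmorphM /= !cst_norm !sigmaM; ring.
Qed.

Lemma norm_cst a : norm (cst a) = a ^+ 4.
Proof. by apply: cst_inj; rewrite cst_norm !sigma_cst rmorphXn /=; ring. Qed.

Lemma norm1 : norm 1 = 1.
Proof. by rewrite -(rmorph1 cst) norm_cst expr1n. Qed.

Lemma norm_root4 : norm root4 = - f.
Proof.
apply: cst_inj; rewrite cst_norm !(sigmaM, sigma_root4, sigma_cst) rmorphN /=.
rewrite -root4_pow4.
have ci2 : cst i ^+ 2 = - 1 by rewrite -rmorphXn /= i2 rmorphN rmorph1.
ring: ci2.
Qed.

Lemma normXn y n : norm (y ^+ n) = norm y ^+ n.
Proof. by elim: n => [|n IHn]; rewrite ?norm1 // !exprS normM IHn. Qed.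

Lemma invertible_norm y : invertible y <-> norm y \is a GRing.unit.
Proof.
split=> [[x eq_yx]|/divrr eq_N].
  apply/unitrP; exists (norm x).
  by rewrite mulrC -!normM eq_yx norm1.
exists (cst (norm y)^-1 * (sigma y * sigma (sigma y) * sigma (sigma (sigma y)))).
transitivity (cst (norm y) * cst (norm y)^-1); last by rewrite -rmorphM eq_N rmorph1.
by rewrite cst_norm; ring.
Qed.

(** All conjugates of [y] are multiples of [y], and so are their linear
    combinations, among which are the projections of [4 * y] to the eigenspaces
    [A * root4 ^+ l] of [sigma]. *)
Lemma eigenvector_dvd_component y e l : sigma y = e * y -> (l < 4)%N ->
  exists t, cst (4 * y`_l) * root4 ^+ l = y * t.
Proof.
move=> eig.
have eig2 : sigma (sigma y) = sigma e * e * y by rewrite eig sigmaM eig; ring.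
have eig3 : sigma (sigma (sigma y)) = sigma (sigma e) * sigma e * e * y.
  by rewrite eig2 !sigmaM eig; ring.
have proj c1 c2 c3 : exists t, y + cst c1 * sigma y + cst c2 * sigma (sigma y)
    + cst c3 * sigma (sigma (sigma y)) = y * t.
  exists (1 + cst c1 * e + cst c2 * (sigma e * e)
            + cst c3 * (sigma (sigma e) * sigma e * e)).
  by rewrite eig3 eig2 eig; ring.
(* The weights of the projections are the powers of [i ^- l]. *)
case: l => [|[|[|[|l]]]] // _.
- have [t eq_t] := proj 1 1 1; exists t; rewrite -{}eq_t.
  rewrite [in RHS](tuple4P y) !sigma_tuple4 !cst_mul_tuple4 !tuple4D mulr1.
  by rewrite cst_tuple4; congr tuple4; ring: i2.
- have [t eq_t] := proj (- i) (- 1) i; exists t; rewrite -{}eq_t.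
  rewrite [in RHS](tuple4P y) !sigma_tuple4 !cst_mul_tuple4 !tuple4D.
  rewrite expr1 mulrC cst_tuple4 !root4_mul_tuple4.
  by congr tuple4; ring: i2.
- have [t eq_t] := proj (- 1) 1 (- 1); exists t; rewrite -{}eq_t.
  rewrite [in RHS](tuple4P y) !sigma_tuple4 !cst_mul_tuple4 !tuple4D.
  rewrite mulrC cst_tuple4 !exprS expr0 mulr1 -!mulrA !root4_mul_tuple4.
  by congr tuple4; ring: i2.
have [t eq_t] := proj i (- 1) (- i); exists t; rewrite -{}eq_t.
rewrite [in RHS](tuple4P y) !sigma_tuple4 !cst_mul_tuple4 !tuple4D.
rewrite mulrC cst_tuple4 !exprS expr0 mulr1 -!mulrA !root4_mul_tuple4.
by congr tuple4; ring: i2.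
Qed.

Lemma unit4 : (4 : A) \is a GRing.unit.
Proof. by rewrite (_ : 4 = 2 * 2) ?unitrM ?unit2 //; ring. Qed.

(** Take norms in [eigenvector_dvd_component]; [root4] has norm [- f]. *)
Lemma eigenvector_norm_dvd y e l : sigma y = e * y -> (l < 4)%N ->
  divides (norm y) (y`_l ^+ 4 * f ^+ l).
Proof.
move=> eig /(eigenvector_dvd_component eig)[t /(congr1 norm)].
rewrite !normM normXn norm_root4 norm_cst => eq_N.
exists ((- 1) ^+ l * 4^-1 ^+ 4 * norm t).
rewrite mulrCA -eq_N exprMn [(- f) ^+ l]exprNn.
have sgn : (- 1 : A) ^+ l * (- 1) ^+ l = 1 by rewrite -exprMn mulrN1 opprK expr1n.
have inv4 : 4^-1 ^+ 4 * (4 : A) ^+ 4 = 1 by rewrite -exprMn mulVr ?unit4 ?expr1n.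
transitivity (((-1) ^+ l * (-1) ^+ l) * (4^-1 ^+ 4 * 4 ^+ 4)
              * (y`_l ^+ 4 * f ^+ l)).
  by rewrite sgn inv4 !mul1r.
by move: (4^-1) ((- 1) ^+ l) => q4 s; ring.
Qed.

(** The averages [avg x] solve the equation.  They do not all vanish, by the
    independence of characters: combined with weights [root4 ^+ (4 - l)], those
    of the powers [root4 ^+ l] add up to [4 * f]. *)
Lemma hilbert90 u : f != 0 -> norm u = 1 -> exists2 y, y != 0 & u * sigma y = y.
Proof.
move=> f0 Nu.
pose avg x := x + u * sigma x + u * sigma u * sigma (sigma x)
                + u * sigma u * sigma (sigma u) * sigma (sigma (sigma x)).
have avgP x : u * sigma (avg x) = avg x.
  have cu : u * sigma u * sigma (sigma u) * sigma (sigma (sigma u)) = 1.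
    by rewrite -cst_norm Nu rmorph1.
  pose s1 := u * sigma x; pose s2 := u * sigma u * sigma (sigma x).
  pose s3 := u * sigma u * sigma (sigma u) * sigma (sigma (sigma x)).
  rewrite /avg (sigmaD (x + s1 + s2) s3) (sigmaD (x + s1) s2) (sigmaD x s1).
  rewrite /s1 /s2 /s3 !sigmaM sigma4.
  move: (sigma u) (sigma (sigma u)) (sigma (sigma (sigma u))) cu => u1 u2 u3.
  move: (sigma x) (sigma (sigma x)) (sigma (sigma (sigma x))) => x1 x2 x3 cu.
  ring: cu.
suff [l avg_l] : exists l, avg (root4 ^+ l) != 0 by exists (avg (root4 ^+ l)).
apply: NNPP => avg0.
have {}avg0 l : avg (root4 ^+ l) = 0.
  by apply/eqP/negPn/negP => avg_l; apply: avg0; exists l.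
have : cst (4 * f) = 0.
  have ci2 : cst i ^+ 2 = - 1 by rewrite -rmorphXn /= i2 rmorphN rmorph1.
  transitivity (root4 ^+ 4 * avg (root4 ^+ 0) + root4 ^+ 3 * avg (root4 ^+ 1)
    + root4 ^+ 2 * avg (root4 ^+ 2) + root4 * avg (root4 ^+ 3)).
    rewrite rmorphM /= -root4_pow4 rmorph_nat /avg.
    rewrite !exprS expr0 mulr1 !(sigmaM, sigma1, sigma_root4, sigma_cst).
    ring: ci2.
  by rewrite !avg0; ring.
rewrite -(rmorph0 cst) => /cst_inj/eqP; rewrite mulf_eq0 (negPf f0) orbF.
by apply/negP; apply: contraTneq unit4 => ->; rewrite unitr0.
Qed.

End Automorphism.

(** * Units up to constants are quotients of conjugates *)

Section Units.

Variable mu : A -> nat.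
Hypothesis mu_deg : degree_function mu.
Hypothesis A_prime : irreducibles_prime A.
Hypothesis f_irr : irreducible_elt f.
Hypothesis unit_root4 : forall a : A, a \is a GRing.unit ->
  exists b, b ^+ 4 = a.
Variable i : A.
Hypothesis i2 : i ^+ 2 = - 1.
Hypothesis unit2 : (2 : A) \is a GRing.unit.

Local Notation sigma := (sigma i).
Local Notation norm := (norm i).

Let f_prime : prime_elt f := A_prime f_irr.
Let f0 : f != 0. Proof. by case: f_prime. Qed.
Let Uf : f \isn't a GRing.unit. Proof. by case: f_prime. Qed.

Lemma prime_divides_exp (p a : A) n :
  prime_elt p -> divides p (a ^+ n) -> divides p a.
Proof.
case=> _ Up p_prime; elim: n => [[b eq1]|n IHn].
  by case/negP: Up; apply/unitrP; exists b; rewrite mulrC -eq1.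
by rewrite exprS => /p_prime[].
Qed.

Lemma root4_mulI x y : root4 * x = root4 * y -> x = y.
Proof.
move=> eq_xy; have: cst f * x = cst f * y.
  by rewrite -root4_pow4 exprSr -!mulrA eq_xy.
rewrite (tuple4P x) (tuple4P y) !cst_mul_tuple4.
by case/tuple4_inj => /(mulfI f0)-> /(mulfI f0)-> /(mulfI f0)-> /(mulfI f0)->.
Qed.

Lemma cst_mulI (p : A) x y : p != 0 -> cst p * x = cst p * y -> x = y.
Proof.
move=> p0; rewrite (tuple4P x) (tuple4P y) !cst_mul_tuple4.
by case/tuple4_inj => /(mulfI p0)-> /(mulfI p0)-> /(mulfI p0)-> /(mulfI p0)->.
Qed.

Lemma eigenvector_norm_neq0 y e : y != 0 -> sigma y = e * y -> norm y != 0.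
Proof.
move=> y0 eig; apply: contraNneq y0 => N0.
have y_l l : (l < 4)%N -> y`_l = 0.
  move=> /(eigenvector_norm_dvd i2 unit2 eig)[t /eqP].
  by rewrite N0 mul0r mulf_eq0 !expf_eq0 (negPf f0) andbF orbF => /eqP.
by rewrite (tuple4P y) !y_l // -cst_tuple4 rmorph0.
Qed.

Lemma i_unit : i \is a GRing.unit.
Proof. by apply/unitrP; exists (- i); rewrite mulNr mulrN -expr2 i2 opprK. Qed.

(** By induction on the degree of the norm of [y].  A prime [p] dividing the norm
    divides every coefficient of [y] if it does not divide [f]
    ([eigenvector_norm_dvd]), and then [y] can be divided by [p].  Otherwise [p]
    is [f] up to a unit and divides the constant coefficient, and [y] can be
    divided by [root4], which is itself an eigenvector. *)
Lemma eigenvector_unit y e : y != 0 -> sigma y = e * y ->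
  exists v c, [/\ invertible v, c \is a GRing.unit & sigma v = cst c * e * v].
Proof.
have [n le_n] := ubnP (mu (norm y)); elim: n => // n IHn in y e le_n *.
move=> y0 eig; have N0 := eigenvector_norm_neq0 y0 eig.
case UN: (norm y \is a GRing.unit).
  exists y, 1; split; rewrite ?unitr1 ?rmorph1 ?mul1r //.
  exact/(invertible_norm i2 unit2).
have [p irr_p [h eq_N]] := exists_irreducible_factor mu_deg N0 (negbT UN).
have p_prime := A_prime irr_p; have [p0 Up p_dvd] := p_prime.
have p_comp l : (l < 4)%N -> divides p y`_l \/ divides p f.
  move=> /(eigenvector_norm_dvd i2 unit2 eig)[t eq_t].
  have /p_dvd[] : divides p (y`_l ^+ 4 * f ^+ l).
  - by exists (h * t); rewrite eq_t eq_N mulrA.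
  - by move/(prime_divides_exp p_prime); left.
  - by move/(prime_divides_exp p_prime); right.
have smaller s y' : s \isn't a GRing.unit -> norm y = s * norm y' ->
    (mu (norm y') < n)%N.
  move=> Us eq_Ny; move: N0; rewrite eq_Ny mulf_eq0 => /norP[s0 N'0].
  move: le_n; rewrite eq_Ny (degM mu_deg) // ltnS; apply: leq_trans.
  by rewrite -addn1 addnC leq_add2r (deg_gt0 mu_deg).
have [[q eq_f]|p'f] := classic (divides p f).
  have Uq : q \is a GRing.unit.
    by have [_ _ /(_ _ _ eq_f)[]//] := f_irr; rewrite (negPf Up).
  have [a eq_a] : divides f y`_0.
    case: (eigenvector_norm_dvd i2 unit2 eig (isT : (0 < 4)%N)) => t eq_t.
    have [a ->] : divides p y`_0.
      apply: (prime_divides_exp (n := 4) p_prime).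
      by exists (h * t); rewrite mulrA -eq_N -eq_t mulr1.
    by exists (q^-1 * a); rewrite eq_f -mulrA mulVKr.
  pose y' := tuple4 y`_1 y`_2 y`_3 a.
  have eq_y : y = root4 * y' by rewrite root4_mul_tuple4 -eq_a -tuple4P.
  have eig' : sigma y' = (cst (- i) * e) * y'.
    apply: root4_mulI; transitivity (cst (- i) * sigma y).
      rewrite eq_y (sigmaM i2) sigma_root4.
      transitivity (cst (- i * i) * (root4 * sigma y')).
        by rewrite mulNr -expr2 i2 opprK rmorph1 mul1r.
      by rewrite rmorphM /=; ring.
    by rewrite eig eq_y; ring.
  have [||v [c [Uv Uc eig_v]]] := IHn y' _ _ _ eig'.
  - apply: (smaller (- f)); first by rewrite unitrN.
    by rewrite {1}eq_y (normM i2 unit2) (norm_root4 i2 unit2).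
  - by apply: contraNneq y0 => y'0; rewrite eq_y y'0 mulr0.
  exists v, (c * - i); split=> //; first by rewrite unitrM Uc unitrN i_unit.
  by rewrite eig_v rmorphM /= !mulrA.
have [[a eq_a] [b eq_b] [c eq_c] [d eq_d]] : [/\ divides p y`_0, divides p y`_1,
    divides p y`_2 & divides p y`_3].
  by split; [case: (p_comp 0%N)|case: (p_comp 1%N)|
             case: (p_comp 2%N)|case: (p_comp 3%N)].
pose y' := tuple4 a b c d.
have eq_y : y = cst p * y'.
  by rewrite (tuple4P y) eq_a eq_b eq_c eq_d cst_mul_tuple4.
apply: (IHn y').
- apply: (smaller (p ^+ 4)); first by rewrite unitrX_pos.
  by rewrite {1}eq_y (normM i2 unit2) (norm_cst i2 unit2).
- by apply: contraNneq y0 => y'0; rewrite eq_y y'0 mulr0.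
apply: (cst_mulI p0); transitivity (sigma y).
  by rewrite eq_y (sigmaM i2) sigma_cst.
by rewrite eig eq_y; ring.
Qed.


(** After scaling to norm [1], the solution of Hilbert's theorem 90 is an
    eigenvector, and [eigenvector_unit] turns it into a unit. *)
Lemma unit_quotient u : invertible u ->
  exists v c, [/\ invertible v, c \is a GRing.unit & u * sigma v = cst c * v].
Proof.
move/(invertible_norm i2 unit2) => UN.
have [r r4] : exists r, r ^+ 4 = (norm u)^-1.
  by apply: unit_root4; rewrite unitrV.
have Ur : r \is a GRing.unit by rewrite -(unitrX_pos r (isT : (0 < 4)%N)) r4 unitrV.
have Nru : norm (cst r * u) = 1.
  by rewrite (normM i2 unit2) (norm_cst i2 unit2) r4 mulVr.
have [y y0 eq_y] := hilbert90 i2 unit2 f0 Nru.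
have [t ru_t] : invertible (cst r * u).
  by apply/(invertible_norm i2 unit2); rewrite Nru unitr1.
have eig : sigma y = t * y by rewrite -{2}eq_y mulrA (mulrC t) ru_t mul1r.
have [v [c [Uv Uc eig_v]]] := eigenvector_unit y0 eig.
exists v, (r^-1 * c); split=> //; first by rewrite unitrM unitrV Ur.
transitivity (cst (r^-1 * r) * u * sigma v).
  by rewrite mulVr // rmorph1 mul1r.
transitivity (cst r^-1 * cst c * (cst r * u * t) * v).
  by rewrite eig_v rmorphM /=; ring.
by rewrite ru_t rmorphM /=; ring.
Qed.

Lemma invertibleM (x y : T) : invertible x -> invertible y -> invertible (x * y).
Proof. by case=> x' xK [y' yK]; exists (x' * y'); rewrite mulrACA xK yK mulr1. Qed.

Lemma invertible_sigma x : invertible x -> invertible (sigma x).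
Proof. by case=> y xy1; exists (sigma y); rewrite -(sigmaM i2) xy1 sigma1. Qed.

Lemma invertible_cst a : invertible (cst a) <-> a \is a GRing.unit.
Proof.
split=> [/(invertible_norm i2 unit2)|Ua].
  by rewrite (norm_cst i2 unit2) unitrX_pos.
by exists (cst a^-1); rewrite -rmorphM divrr ?rmorph1.
Qed.

Lemma mulI_invertible (x : T) : invertible x -> injective ( *%R x).
Proof.
case=> x' xK; apply: (can_inj (g := *%R x')) => y.
by rewrite mulrA (mulrC x') xK mul1r.
Qed.

Lemma root4_not_invertible x : ~ invertible (root4 * x).
Proof.
move/(invertible_norm i2 unit2).
rewrite (normM i2 unit2) (norm_root4 i2 unit2) unitrM unitrN.
by rewrite (negPf Uf).
Qed.

(** * Units fixed by the square of the automorphism *)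

(** If [u = c * g / sigma g] is fixed by [sigma ^ 2], then [sigma ^ 2 g / g] is
    fixed by [sigma], hence a scalar.  If that is [1], then [g] is fixed by
    [sigma ^ 2]; otherwise it is [-1] and the non-unit [root4] divides [g]. *)
Lemma unit_quotient_fixed a c : invertible (tuple4 a 0 c 0) ->
  exists a' c' e, [/\ e \is a GRing.unit, invertible (tuple4 a' 0 c' 0) &
    tuple4 a 0 c 0 * sigma (tuple4 a' 0 c' 0) = cst e * tuple4 a' 0 c' 0].
Proof.
set u := tuple4 a 0 c 0 => Uu.
have [g [e [Ug Ue eq_g]]] := unit_quotient Uu.
have eq_g2 : u * sigma (sigma (sigma g)) = cst e * sigma (sigma g).
  have {1}-> : u = sigma (sigma u) by rewrite sigma2_tuple4 // oppr0.
  by rewrite -!(sigmaM i2) eq_g !(sigmaM i2) !sigma_cst.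
have [h gh1] := Ug.
pose r := sigma (sigma g) * h.
have eq_r : sigma (sigma g) = r * g by rewrite /r -mulrA (mulrC h) gh1 mulr1.
have r_fixed : sigma r = r.
  apply: (mulI_invertible (invertibleM Uu (invertibleM Ug (invertible_sigma Ug)))).
  transitivity (u * sigma (r * g) * g); first by rewrite (sigmaM i2); ring.
  rewrite -eq_r eq_g2.
  transitivity ((cst e * g) * (r * g)); first by rewrite eq_r; ring.
  by rewrite -eq_g; ring.
have := eq_r; rewrite (sigma_fixed i2 unit2 r_fixed); move: (r`_0) => r0.
move: Ug eq_g; rewrite (tuple4P g).
move: (g`_0) (g`_1) (g`_2) (g`_3) => g0 g1 g2 g3 Ug eq_g.
rewrite sigma2_tuple4 // cst_mul_tuple4 => /tuple4_inj[r_g0 r_g1 r_g2 r_g3].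
have [r1|r1] := eqVneq r0 1.
  exists g0, g2, e; have g13 : g1 = 0 /\ g3 = 0.
    by split; apply: (double_eq0 unit2); rewrite ?r_g1 ?r_g3 r1 mul1r.
  by case: g13 Ug eq_g => -> ->.
have zero x : x = r0 * x -> x = 0.
  move/eqP; rewrite -subr_eq0 -{1}[x]mul1r -mulrBl mulf_eq0 subr_eq0 eq_sym.
  by rewrite (negPf r1) => /eqP.
case: (@root4_not_invertible (tuple4 g1 0 g3 0)).
by rewrite root4_mul_tuple4 mulr0; move: Ug; rewrite (zero _ r_g0) (zero _ r_g2).
Qed.

Lemma deg_const_add a b : mu a = 0%N -> mu b = 0%N -> mu (a + b) = 0%N.
Proof. by move=> a0 b0; have := deg_leD mu_deg a b; rewrite a0 b0 leqn0 => /eqP. Qed.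

Lemma deg_const_mul a b : mu a = 0%N -> mu b = 0%N -> mu (a * b) = 0%N.
Proof.
have [->|a0] := eqVneq a 0; first by rewrite mul0r.
have [->|b0] := eqVneq b 0; first by rewrite mulr0.
by rewrite (degM mu_deg) // => -> ->.
Qed.

Lemma degD_const a b : mu b = 0%N -> mu (a + b) = mu a.
Proof.
move=> b0; have := deg_leD mu_deg a b.
have := deg_leD mu_deg (a + b) (- b); rewrite addrK (degN mu_deg) b0.
by move: (mu a) (mu _) => *; lia.
Qed.

Lemma deg_const_mul_f a : mu (f * a) = 0%N -> a = 0.
Proof.
have [//|a0] := eqVneq a 0; rewrite (degM mu_deg) // => /eqP.
by rewrite addn_eq0 eqn0Ngt (deg_gt0 mu_deg).
Qed.

(** Put [w = root4 ^+ 2].  The unit is, up to a constant, the square of a unit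
    [g = a' + c' * w] with [a' ^+ 2 - f * c' ^+ 2 = b] constant, and the constant
    coefficient of [g ^+ 2] is [2 * a' ^+ 2 - b], of twice the degree of [a'] if
    [a'] is not constant.  If it is, [f * c' ^+ 2] is constant and [c'] is zero. *)
Lemma unit_fixed_const a c : invertible (tuple4 a 0 c 0) -> c = 0.
Proof.
have [n le_n] := ubnP (mu a); elim: n => // n IHn in a c le_n * => Uu.
have [a' [c' [e [Ue Ug eq_u]]]] := unit_quotient_fixed Uu.
have Ng : tuple4 a' 0 c' 0 * sigma (tuple4 a' 0 c' 0) =
    cst (a' ^+ 2 - f * c' ^+ 2).
  by rewrite sigma_tuple4 tuple4M cst_tuple4; congr tuple4; ring.
set b := _ - _ in Ng.
have Ub : b \is a GRing.unit.
  by apply/invertible_cst; rewrite -Ng; apply: invertibleM Ug (invertible_sigma Ug).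
have : cst b * tuple4 a 0 c 0 = cst e * (tuple4 a' 0 c' 0 * tuple4 a' 0 c' 0).
  rewrite -Ng; move: (tuple4 a 0 c 0) (tuple4 a' 0 c' 0) eq_u => u g eq_u.
  by transitivity (g * (u * sigma g)); [ring|rewrite eq_u; ring].
rewrite tuple4M !cst_mul_tuple4 => /tuple4_inj[eq_a _ eq_c _].
have b_const := deg_unit mu_deg Ub; have e_const := deg_unit mu_deg Ue.
suff c'0 : c' = 0.
  apply: (mulrI Ub); rewrite mulr0 eq_c c'0; ring.
have mu_a : mu a = mu (2 * a' ^+ 2).
  rewrite -(degMunit mu_deg a Ub) eq_a (degMunit mu_deg _ Ue).
  rewrite -(@degD_const (2 * a' ^+ 2) (- b)) ?(degN mu_deg) //.
  by congr mu; rewrite /b; ring.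
have [a'0|a'_gt0] := posnP (mu a').
  suff /eqP : c' ^+ 2 = 0 by rewrite expf_eq0 => /eqP.
  apply: deg_const_mul_f; rewrite (_ : f * c' ^+ 2 = a' * a' + - b).
    by rewrite deg_const_add ?(degN mu_deg) ?deg_const_mul.
  by rewrite /b; ring.
apply: (IHn a' c') => //.
have a'0 : a' != 0 by apply: contraTneq a'_gt0 => ->; rewrite (deg0 mu_deg).
move: le_n; rewrite mu_a (degMunit mu_deg) // expr2 (degM mu_deg) //.
by move: a'_gt0; move: (mu _) => *; lia.
Qed.

(** * Units up to constants are squares *)

Lemma invertible_fixed_cst y : invertible y -> sigma (sigma y) = y ->
  exists2 b, b \is a GRing.unit & y = cst b.
Proof.
rewrite (tuple4P y); move: (y`_0) (y`_1) (y`_2) (y`_3) => a b c d Uy.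
rewrite sigma2_tuple4 // => /tuple4_inj[_ eq_b _ eq_d].
have b0 : b = 0 by apply: (double_eq0 unit2).
have d0 : d = 0 by apply: (double_eq0 unit2).
move: Uy; rewrite b0 d0 => Uy; move: (Uy); rewrite (unit_fixed_const Uy).
by rewrite -cst_tuple4 => /invertible_cst Ua; exists a.
Qed.

Lemma invertible_norm_sigma2 y : invertible y ->
  exists2 b, b \is a GRing.unit & y * sigma (sigma y) = cst b.
Proof.
move=> Uy; apply: invertible_fixed_cst.
  by apply: invertibleM => //; do 2 apply: invertible_sigma.
by rewrite !(sigmaM i2) sigma4 // mulrC.
Qed.

(** From [u = c0 * w / sigma w] and [w = c1 * v / sigma v] follows
    [u = c0 * (v * sigma (sigma v)) * (sigma v^-1) ^+ 2], where [v * sigma (sigma v)]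
    is constant. *)
Lemma unit_square u : invertible u -> exists g c b,
  [/\ invertible g, c \is a GRing.unit, u = cst c * g ^+ 2 &
     g * sigma (sigma g) = cst b].
Proof.
move=> Uu; have [w [c0 [Uw Uc0 eq_u]]] := unit_quotient Uu.
have [v [c1 [Uv Uc1 eq_w]]] := unit_quotient Uw.
have [b0 Ub0 eq_b0] := invertible_norm_sigma2 Uv.
have [x vx1] := Uv.
have Ug : invertible (sigma x) by apply: invertible_sigma; exists v; rewrite mulrC.
have [b _ eq_b] := invertible_norm_sigma2 Ug.
exists (sigma x), (c0 * b0), b; split=> //; first by rewrite unitrM Uc0.
have c1_neq0 : c1 != 0 by apply: contraTneq Uc1 => ->; rewrite unitr0.
have vx1s : sigma v * sigma x = 1 by rewrite -(sigmaM i2) vx1 sigma1.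
have vx1s2 : sigma (sigma v) * sigma (sigma x) = 1.
  by rewrite -(sigmaM i2) vx1s sigma1.
have eq_w1 : w = cst c1 * v * sigma x.
  by rewrite -eq_w -mulrA vx1s mulr1.
have eq_sw : sigma w = cst c1 * sigma v * sigma (sigma x).
  by rewrite eq_w1 !(sigmaM i2) sigma_cst.
apply: (cst_mulI c1_neq0).
rewrite rmorphM /= -eq_b0.
move: eq_u vx1s vx1s2; rewrite eq_sw eq_w1.
move: (sigma v) (sigma x) (sigma (sigma v)) (sigma (sigma x)) => v1 x1 v2 x2.
move=> eq_u vx1s vx1s2.
transitivity (u * (cst c1 * v1 * x2) * x1 * v2).
  transitivity (cst c1 * u * (v1 * x1) * (v2 * x2)); last by ring.
  by rewrite vx1s vx1s2 !mulr1.
by rewrite eq_u; ring.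
Qed.

(** Infinite descent: [f] divides [x], then [y], and can be cancelled from both. *)
Lemma square_eq_f_square x y : x ^+ 2 + f * y ^+ 2 = 0 -> x = 0 /\ y = 0.
Proof.
have f_dvd_square a b : a ^+ 2 + f * b = 0 -> divides f a.
  move=> /eqP; rewrite addr_eq0 => /eqP eq_a.
  by apply: (prime_divides_exp (n := 2) f_prime); exists (- b); rewrite eq_a mulrN.
have [n le_n] := ubnP (mu y); elim: n => // n IHn in x y le_n * => eq_xy.
have [x' eq_x] := f_dvd_square _ _ eq_xy.
have eq_x'y : y ^+ 2 + f * x' ^+ 2 = 0.
  by apply: (mulfI f0); rewrite mulr0 -eq_xy eq_x; ring.
have [y' eq_y] := f_dvd_square _ _ eq_x'y.
have eq_x'y' : x' ^+ 2 + f * y' ^+ 2 = 0.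
  by apply: (mulfI f0); rewrite mulr0 -eq_x'y eq_y; ring.
have [y'0|y'0] := eqVneq y' 0.
  move: eq_x'y'; rewrite y'0 expr0n mulr0 addr0 => /eqP.
  by rewrite expf_eq0 => /eqP x'0; rewrite eq_x eq_y x'0 y'0 mulr0.
have [|x'0 y'_0] := IHn x' y' _ eq_x'y'; last by rewrite y'_0 eqxx in y'0.
move: le_n; rewrite eq_y (degM mu_deg) // ltnS; apply: leq_trans.
by rewrite -addn1 addnC leq_add2r (deg_gt0 mu_deg).
Qed.

Lemma norm_sigma2_coefs g b : g * sigma (sigma g) = cst b ->
  g`_0 ^+ 2 + f * (g`_2 ^+ 2 - 2 * g`_1 * g`_3) = b /\
  2 * g`_0 * g`_2 = g`_1 ^+ 2 + f * g`_3 ^+ 2.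
Proof.
rewrite {1 2}(tuple4P g); move: (g`_0) (g`_1) (g`_2) (g`_3) => g0 g1 g2 g3.
rewrite sigma2_tuple4 // tuple4M cst_tuple4 => /tuple4_inj[eq0 _ eq2 _].
split; first by rewrite -eq0; ring.
by apply/eqP; rewrite -subr_eq0 -eq2; apply/eqP; ring.
Qed.

(** The coefficient of [root4 ^+ 2] in [g * sigma (sigma g) = cst b] turns the
    vanishing of [g_0 * g_2] into that of [g_1 ^+ 2 + f * g_3 ^+ 2]. *)
Lemma norm_sigma2_degenerate g b : g * sigma (sigma g) = cst b ->
  b \is a GRing.unit -> g`_0 * g`_2 = 0 -> g = cst g`_0.
Proof.
move=> /norm_sigma2_coefs[eq_b eq_2] Ub g02.
have [g1 g3] : g`_1 = 0 /\ g`_3 = 0.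
  by apply: square_eq_f_square; rewrite -eq_2 -mulrA g02 mulr0.
move/eqP: g02; rewrite mulf_eq0 => /orP[/eqP g0|/eqP g2].
  case/negP: Uf; move: Ub; rewrite -eq_b g0 expr0n add0r unitrM.
  by case/andP.
by rewrite {1}(tuple4P g) g1 g2 g3 -cst_tuple4.
Qed.

(** The relations of [norm_sigma2_coefs] eliminate [g_1] and [g_3] from the even
    coefficients of [g ^+ 2]. *)
Lemma unit_square_coefs (u : T) : invertible u -> exists (g : T) c,
  [/\ invertible g, c \is a GRing.unit,
      exists2 b, mu b = 0%N & u`_0 = c * (2 * (g`_0 ^+ 2 + f * g`_2 ^+ 2) + b),
      u`_2 = 4 * c * (g`_0 * g`_2) &
      (g`_0 * g`_2 = 0 -> u = cst u`_0)].
Proof.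
move=> Uu; have [g [c [b [Ug Uc eq_u eq_b]]]] := unit_square Uu.
have Ub : b \is a GRing.unit.
  by apply/invertible_cst; rewrite -eq_b; apply: invertibleM => //;
     do 2 apply: invertible_sigma.
have [eq0 eq2] := norm_sigma2_coefs eq_b.
have eq_uE : u = cst c * (g * g) by rewrite eq_u expr2.
exists g, c; split=> //.
- exists (- b); first by rewrite (degN mu_deg) (deg_unit mu_deg).
  rewrite eq_uE {1 2}(tuple4P g) tuple4M cst_mul_tuple4 coef_tuple4 /= -eq0.
  by ring.
- rewrite eq_uE {1 2}(tuple4P g) tuple4M cst_mul_tuple4 coef_tuple4 /=.
  transitivity (c * (2 * g`_0 * g`_2 + (g`_1 ^+ 2 + f * g`_3 ^+ 2))); first by ring.
  by rewrite -eq2; ring.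
move=> g02; rewrite eq_uE (norm_sigma2_degenerate eq_b Ub g02) -!rmorphM /=.
by rewrite coef_cst.
Qed.

(** Extract a square root twice, [u ~ g ^+ 2] and [g ~ h ^+ 2].  If [g_0 * g_2]
    or [h_0 * h_2] vanishes, [u] is constant.  If not, up to units
    [u_2 = g_0 * g_2 = g_0 * h_0 * h_2], so [h_2] has smaller degree than [u_2]
    unless [g_0] and [h_0] are constant; and in that case
    [g_0 = c' * (2 * (h_0 ^+ 2 + f * h_2 ^+ 2) + b')] would force [h_2 = 0]. *)
Lemma invertible_quartic (u : T) : invertible u -> u = cst u`_0.
Proof.
have [n le_n] := ubnP (mu u`_2); elim: n => // n IHn in u le_n *.
move=> Uu; have [g [c [Ug Uc _ eq_u2 degen_u]]] := unit_square_coefs Uu.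
have [h [c' [Uh Uc' [b' b'0 eq_g0] eq_g2 _]]] := unit_square_coefs Ug.
have [/degen_u //|g02] := eqVneq (g`_0 * g`_2) 0.
have [|h02] := eqVneq (h`_0 * h`_2) 0.
  by move=> h02; apply: degen_u; rewrite eq_g2 h02 !mulr0.
have h_nonconst : h`_2 <> 0 by move=> h2; rewrite h2 mulr0 eqxx in h02.
move: g02 h02; rewrite !mulf_eq0 => /norP[g0 g2] /norP[h0 h2].
have mu_u : mu u`_2 = (mu g`_0 + mu g`_2)%N.
  by rewrite eq_u2 (degMunit mu_deg) ?unitrM ?unit4 // (degM mu_deg).
have mu_g : mu g`_2 = (mu h`_0 + mu h`_2)%N.
  by rewrite eq_g2 (degMunit mu_deg) ?unitrM ?unit4 // (degM mu_deg).
case: h_nonconst; have [g_const|g_pos] := posnP (mu g`_0); last first.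
  rewrite (IHn h _ Uh) ?coef_cst //.
  by move: le_n; rewrite mu_u mu_g; move: g_pos; clear; lia.
have [h_const|h_pos] := posnP (mu h`_0); last first.
  rewrite (IHn h _ Uh) ?coef_cst //.
  by move: le_n; rewrite mu_u mu_g; move: h_pos; clear; lia.
have : f * (2 * h`_2 ^+ 2) = c'^-1 * g`_0 + (- (2 * (h`_0 * h`_0)) - b').
  by rewrite eq_g0 mulKr; first by ring.
move/(congr1 mu); rewrite deg_const_add; last 2 first.
- by rewrite (degMunit mu_deg) ?unitrV.
- rewrite deg_const_add ?(degN mu_deg) //.
  by rewrite (degMunit mu_deg) // deg_const_mul.
move/deg_const_mul_f/eqP; rewrite mulf_eq0 expf_eq0 /= => /orP[/eqP two0|/eqP //].
by move: unit2; rewrite two0 unitr0.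
Qed.

End Units.

End QuarticExtension.

(** * Units of the quartic cover *)

Lemma closed_field_root (k : closedFieldType) (a : k) n : (0 < n)%N ->
  exists b, b ^+ n = a.
Proof.
move=> n_gt0; have /closed_rootP[b] : size (('X : {poly k}) ^+ n - a%:P) != 1.
  by rewrite size_XnsubC // eqSS -lt0n.
rewrite /root !hornerE subr_eq0 => /eqP eq_b.
by exists b.
Qed.

Theorem theorem2p12 (k : closedFieldType) (m : nat) (f : {mpoly k[m]}) :
  (4%:R : k) \is a GRing.unit -> (1 <= m)%N -> irreducible_elt f ->
  forall u : {poly %/ quartic f},
    invertible u <-> exists2 c : k, c \is a GRing.unit & u = quartic_const f c.
Proof.
move=> unit4 _ f_irr u; rewrite /quartic_const.
have unit2 : (2 : {mpoly k[m]}) \is a GRing.unit.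
  rewrite -(rmorph_nat (@mpolyC m k)); apply: rmorph_unit.
  by move: unit4; rewrite (natrM _ 2 2) unitrM => /andP[].
have unit_const a : a \is a GRing.unit ->
    exists2 c : k, c \is a GRing.unit & a = c%:MP :> {mpoly k[m]}.
  by case/andP=> /eqP eq_a Ua; exists a@_0.
split=> [Uu|[c Uc ->]]; last first.
  by exists (qpolyC _ c^-1%:MP); rewrite -!rmorphM divrr ?rmorph1.
have unit_root4 a : a \is a GRing.unit -> exists b : {mpoly k[m]}, b ^+ 4 = a.
  case/unit_const => c _ ->; have [b <-] := closed_field_root c (isT : (0 < 4)%N).
  by exists b%:MP; rewrite rmorphXn.
have [i0 i0_2] := closed_field_root (- 1 : k) (isT : (0 < 2)%N).
have i2 : (i0%:MP : {mpoly k[m]}) ^+ 2 = - 1 by rewrite -rmorphXn i0_2 rmorphN1.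
have A_prime := @mpoly_irreducibles_prime k m.
have eq_u := invertible_quartic (@mdegreeP k m) A_prime f_irr unit_root4 i2 unit2 Uu.
have [|c Uc eq_c] := unit_const u`_0.
  apply/(invertible_cst f i2 unit2); rewrite -eq_u //.
by exists c; rewrite // -eq_c.
Qed.
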